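(* Let $Z=\{\zeta_1,\dots,\zeta_{|Z|}\}\subset\mathbb{C}$ be a finite set, and suppose $\mathbf{f}=[f_1,\dots,f_N]:\mathbb{C}\to\mathbb{C}^N$ can be approximated on $Z$ by the set-valued rational function $\mathbf{r}_m=[r_{m,1},\dots,r_{m,N}]$ with support points $Z_m=\{z_1,\dots,z_m\}\subset Z$, given in barycentric form $$\mathbf{r}_m(z)=\left(\sum_{\nu=1}^m\frac{w_\nu\,\mathbf{f}(z_\nu)}{z-z_\nu}\right)\Big/\left(\sum_{\nu=1}^m\frac{w_\nu}{z-z_\nu}\right),$$ such that for some $\epsilon>0$ $$\sup_{z\in Z}\|\mathbf{f}(z)-\mathbf{r}_m(z)\|_p<\epsilon .$$ Let $F,\widetilde F_m\in\mathbb{C}^{|Z|\times N}$ be the matrices with entries $F(i,j)=f_j(\zeta_i)$ and $\widetilde F_m(i,j)=r_{m,j}(\zeta_i)$, where $F$ is scaled such that $\|F(:,j)\|_\infty=1$ for all $j$. Then the matrix $\widetilde F_m$ is of rank $m$, and can be written as $$\widetilde F_m=H_m\cdot F(Z_m,:)$$ with $H_m\in\mathbb{C}^{|Z|\times m}$. Thus, $F\approx\widetilde F_m=H_m\cdot F(Z_m,:)$ constitutes an approximate row interpolative decomposition with respect to the row-wise $\|\cdot\|_{p,\infty}$-norm, by which is meant $$\|F-\widetilde F_m\|_{p,\infty}:=\max_{1\le i\le |Z|}\|F(i,:)-\widetilde F_m(i,:)\|_p<\epsilon .$$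
   Context: Here $p\in[1,\infty]$ and $\|\cdot\|_p$ is the $\ell^p$-norm on $\mathbb{C}^N$. The support points $z_1,\dots,z_m$ are pairwise distinct and the weights $w_1,\dots,w_m$ are nonzero complex numbers with $\sum_\nu|w_\nu|^2=1$. The barycentric expression for $\mathbf{r}_m$ is understood in the limit sense at the support points. $F(i,:)$ and $F(:,j)$ denote the $i$-th row and $j$-th column of $F$; $F(Z_m,:)\in\mathbb{C}^{m\times N}$ denotes the submatrix of $F$ consisting of the rows corresponding to the points of $Z_m$, i.e. its $\nu$-th row is $[f_1(z_\nu),\dots,f_N(z_\nu)]$. An approximate row interpolative decomposition (RID) of a matrix $A\in\mathbb{C}^{n_1\times n_2}$ with respect to a matrix norm $\|\cdot\|$ is a decomposition $A\approx A_m=H_m\cdot A(I_m,:)$ with $H_m\in\mathbb{C}^{n_1\times m}$ and $I_m$ a set of $m$ row indices, such that $\|A-A_m\|$ is sufficiently small.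
   Formalization: ''Rank m'' fails in general (f=1, N=1, Z=Z_m={0,1}: rank 1, m=2); what is proved is rank at most m, with equality exactly when the rows of F(Z_m,:) are linearly independent. It is also made explicit that r_m has no poles on Z. *)

(* Defs.v *)
From HB Require Import structures.
From mathcomp Require Export all_boot all_order all_algebra.
From mathcomp Require Export complex.
From mathcomp Require Export all_classical all_reals all_analysis.

Set Implicit Arguments.
Unset Strict Implicit.
Unset Printing Implicit Defensive.

Import Order.TTheory GRing.Theory Num.Theory numFieldNormedType.Exports.
Local Open Scope classical_set_scope.
Local Open Scope ring_scope.
Local Open Scope complex_scope.

Section Barycentric.
Variables (K : numFieldType) (m : nat) (z w : 'I_m -> K).

Definition bary_num (g : K -> K) (x : K) : K :=
  \sum_(nu < m) w nu * g (z nu) / (x - z nu).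

Definition bary_den (x : K) : K := \sum_(nu < m) w nu / (x - z nu).

Definition bary_quot (g : K -> K) (x : K) : K := bary_num g x / bary_den x.

(* The points at which the barycentric expression is undefined: the support
   points, and the zeros of the denominator. *)
Definition bary_exceptional (x : K) : bool :=
  (x \in codom z) || (bary_den x == 0).

(* One component of the rational function: the barycentric quotient where it
   is defined, and its limit at the exceptional points.  Where that limit does
   not exist (a pole) the value is meaningless; see [bary_finite]. *)
Definition bary (g : K -> K) (x : K) : K :=
  if bary_exceptional x then lim (bary_quot g y @[y --> x^'])
  else bary_quot g x.

(* x is not a pole.  At a support point with nonzero weight there is nothing
   to require, the limit there being g x. *)
Definition bary_finite (g : K -> K) (x : K) : Prop :=
  x \notin codom z -> bary_den x = 0 -> cvg (bary_quot g y @[y --> x^']).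

Definition bary_vec (N : nat) (f : K -> 'rV[K]_N) (x : K) : 'rV[K]_N :=
  \row_(j < N) bary (fun y => f y 0 j) x.

Definition sample_mx (n N : nat) (g : K -> 'rV[K]_N) (x : 'I_n -> K) :
    'M[K]_(n, N) :=
  \matrix_(i < n, j < N) g (x i) 0 j.

End Barycentric.

Section Norms.
Variable R : realType.

(* Meant for 1 <= p only; p = +oo gives the maximum norm. *)
Definition lp_norm (p : \bar R) (N : nat) (v : 'rV[R[i]]_N) : R :=
  match p with
  | EFin q => (\sum_(j < N) Normc.normc (v 0 j) `^ q) `^ q^-1
  | _ => \big[Num.max/0]_(j < N) Normc.normc (v 0 j)
  end.

Definition lpinf_norm (p : \bar R) (n N : nat) (A : 'M[R[i]]_(n, N)) : R :=
  \big[Num.max/0]_(i < n) lp_norm p (row i A).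

(* "Sufficiently small" error is made explicit as "below eps". *)
Definition approx_RID (n1 n2 m : nat) (nrm : 'M[R[i]]_(n1, n2) -> R) (eps : R)
    (A Am : 'M[R[i]]_(n1, n2)) (H : 'M[R[i]]_(n1, m)) (I : 'I_m -> 'I_n1) :=
  [/\ injective I, Am = H *m rowsub I A & nrm (A - Am) < eps].

End Norms.

(* Main.v *)
(* Multiplying numerator and denominator by y - z_nu shows that r_m interpolates
   f at z_nu, so FZ is a row submatrix of Fm.  Conversely, every linear relation
   c among the columns of FZ makes sum_j c_j * (numerator of r_j) vanish
   identically, and this passes to the limits that define r_m at a removable
   zero of the denominator; hence the right kernel of FZ annihilates Fm, i.e.
   the rows of Fm lie in the row space of FZ.  No explicit formula for H, nor
   any order of vanishing of the denominator, is needed. *)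
Require Import Defs.
Import Order.TTheory GRing.Theory Num.Theory numFieldNormedType.Exports.
Local Open Scope classical_set_scope.
Local Open Scope ring_scope.
Local Open Scope complex_scope.

(** The residue at [z nu]: terms with [k != nu] are regular there and are killed by the factor
    [y - z nu], while the [nu]-th term equals [a nu] off [z nu]. *)
Lemma cvgr_simple_pole {K : numFieldType} {m : nat} {z : 'I_m -> K}
    (z_inj : injective z) (a : 'I_m -> K) (nu : 'I_m) :
  (y - z nu) * (\sum_(k < m) a k / (y - z k)) @[y --> (z nu)^'] --> a nu.
Proof.
have -> : a nu = \sum_(k < m) (if k == nu then a nu else 0).
  by rewrite -big_mkcond big_pred1_eq.
under eq_fun do rewrite mulr_sumr.
apply: cvg_big => [|k _]; first by exact: add_continuous.
have [->|k_nu] := eqVneq k nu.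
  apply: (@cvg_trans _ (a nu @[_ --> (z nu)^'])); last exact: cvg_cst.
  apply: near_eq_cvg; near=> y; rewrite mulrCA mulfV ?mulr1// subr_eq0.
  by near: y; exact: nbhs_dnbhs_neq.
have zk : z nu - z k != 0 by rewrite subr_eq0 (inj_eq z_inj) eq_sym.
(* The limit 0 is recast as the value at [z nu] of a function continuous there. *)
have -> : 0 = (z nu - z nu) * (a k / (z nu - z k)) by rewrite subrr mul0r.
apply: cvg_within_filter.
have y_cvg (b : K) : y - b @[y --> z nu] --> z nu - b.
  exact: cvgB cvg_id (cvg_cst b).
exact: cvgM (y_cvg _) (cvgM (cvg_cst _) (cvgV zk (y_cvg _))).
Unshelve. all: by end_near. Qed.

Lemma bary_quot_cvg_support {K : numFieldType} {m : nat} {z w : 'I_m -> K}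
    (z_inj : injective z) (w_neq0 : forall nu, w nu != 0) (g : K -> K)
    (nu : 'I_m) :
  bary_quot z w g y @[y --> (z nu)^'] --> g (z nu).
Proof.
have -> : g (z nu) = w nu * g (z nu) * (w nu)^-1.
  by rewrite mulrC mulrA mulVf ?mul1r.
have num_cvg := cvgr_simple_pole z_inj (fun k => w k * g (z k)) nu.
have den_cvg := cvgr_simple_pole z_inj w nu.
apply: cvg_trans; last exact: cvgM num_cvg (cvgV (w_neq0 nu) den_cvg).
apply: near_eq_cvg; near=> y => /=.
have yz : y - z nu != 0.
  by rewrite subr_eq0; near: y; exact: nbhs_dnbhs_neq.
by rewrite /bary_quot invfM mulrACA mulfV// mul1r.
Unshelve. all: by end_near. Qed.

Lemma bary_support {K : numFieldType} {m : nat} {z w : 'I_m -> K}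
    (z_inj : injective z) (w_neq0 : forall nu, w nu != 0) (g : K -> K)
    (nu : 'I_m) :
  bary z w g (z nu) = g (z nu).
Proof.
rewrite /bary /bary_exceptional codom_f /=.
by apply: cvg_lim; [exact: norm_hausdorff | exact: bary_quot_cvg_support].
Qed.

Lemma bary_cvg {K : numFieldType} {m : nat} {z w : 'I_m -> K}
    (z_inj : injective z) (w_neq0 : forall nu, w nu != 0) (g : K -> K) (x : K) :
  bary_finite z w g x -> bary_exceptional z w x ->
  bary_quot z w g y @[y --> x^'] --> bary z w g x.
Proof.
move=> fin exc; rewrite /bary exc; case: (boolP (x \in codom z)) => xz.
  have /codomP[nu ->] := xz; apply: (cvgP (g (z nu))).
  exact: bary_quot_cvg_support.
by apply: fin => //; move: exc; rewrite /bary_exceptional (negPf xz) => /eqP.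
Qed.

Lemma bary_lin_rel {K : numFieldType} {m N : nat} {z w : 'I_m -> K}
    (z_inj : injective z) (w_neq0 : forall nu, w nu != 0)
    (g : 'I_N -> K -> K) (c : 'I_N -> K) (x : K) :
  (forall j, bary_finite z w (g j) x) ->
  (forall nu, \sum_(j < N) g j (z nu) * c j = 0) ->
  \sum_(j < N) bary z w (g j) x * c j = 0.
Proof.
move=> fin gc.
(* The denominator does not depend on [j], and the relation kills each coefficient of the combined
   numerator. This holds at every [y], even where a division by 0 occurs, since the inverse of 0 is
   0. *)
have quot0 y : \sum_(j < N) bary_quot z w (g j) y * c j = 0.
  rewrite /bary_quot /bary_num.
  under eq_bigr do rewrite mulrAC mulr_suml.
  rewrite -mulr_suml exchange_big big1 ?mul0r// => nu _ /=.
  under eq_bigr do rewrite (mulrAC (w nu)) -mulrA.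
  by rewrite -mulr_sumr gc mulr0.
case: (boolP (bary_exceptional z w x)) => exc; last first.
  by rewrite -[RHS](quot0 x); apply: eq_bigr => j _; rewrite /bary (negPf exc).
have sum_cvg : \sum_(j < N) bary_quot z w (g j) y * c j @[y --> x^'] -->
    \sum_(j < N) bary z w (g j) x * c j.
  apply: cvg_big => [|j _]; first by exact: add_continuous.
  by apply: cvgM; [exact: bary_cvg | exact: cvg_cst].
move/(cvg_lim (@norm_hausdorff _ _)): sum_cvg => <-.
under eq_fun do rewrite quot0.
by apply: lim_cst; exact: norm_hausdorff.
Qed.

Lemma sample_bary_sub {K : numFieldType} {m n N : nat} {z w : 'I_m -> K}
    (z_inj : injective z) (w_neq0 : forall nu, w nu != 0)
    (zeta : 'I_n -> K) (f : K -> 'rV[K]_N) :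
  (forall i j, bary_finite z w (fun y => f y 0 j) (zeta i)) ->
  (sample_mx (bary_vec z w f) zeta <= sample_mx f z)%MS.
Proof.
(* Only the product with the cokernel matrix being 0 matters: each of its columns is a relation [c]
   as in [bary_lin_rel]. *)
move=> fin; rewrite submxE; move: (cokermx _) (mulmx_coker (sample_mx f z)).
move=> C /matrixP FC; apply/eqP/matrixP => i l; rewrite !mxE.
under eq_bigr do rewrite !mxE.
apply: (bary_lin_rel z_inj w_neq0) => // nu.
by have := FC nu l; rewrite !mxE; under eq_bigr do rewrite mxE.
Qed.

Lemma lpinf_norm_lt_sup {R : realType} (p : \bar R) {n N : nat} (eps : R)
    (zeta : 'I_n -> R[i]) (f g : R[i] -> 'rV[R[i]]_N) :
  0 < eps ->
  sup [set lp_norm p (f x - g x) | x in range zeta] < eps ->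
  lpinf_norm p (sample_mx f zeta - sample_mx g zeta) < eps.
Proof.
(* [eps_gt0] bounds the default value 0 of the maximum. *)
move=> eps_gt0 sup_lt; apply: bigmax_lt => // i _; apply: le_lt_trans sup_lt.
apply: ub_le_sup; last first.
  exists (zeta i); first by exists i.
  by congr lp_norm; apply/rowP => j; rewrite !mxE.
(* A real [sup] dominates its set only if the set is bounded above; here the set is finite. *)
exists (\big[Num.max/0]_(i < n) lp_norm p (f (zeta i) - g (zeta i))).
by move=> _ [_ [k _ <-] <-]; exact: le_bigmax.
Qed.

(** Rank exactly [m] is impossible when [N < m], so the rank claim is a bound together with a
    criterion for equality. *)
Theorem theorem2p1 (R : realType) (p : \bar R) (hp : (1 <= p)%E)
  (n N m : nat)
  (zeta : 'I_n -> R[i]) (zeta_inj : injective zeta)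
  (f : R[i] -> 'rV[R[i]]_N)
  (z : 'I_m -> R[i]) (z_inj : injective z)
  (z_sub : forall nu, z nu \in codom zeta)
  (w : 'I_m -> R[i]) (w_neq0 : forall nu, w nu != 0)
  (w_norm : \sum_(nu < m) Normc.normc (w nu) ^+ 2 = 1)
  (r_finite : forall i j, bary_finite z w (fun y => f y 0 j) (zeta i))
  (eps : R) (eps_gt0 : 0 < eps)
  (r_approx :
    sup [set lp_norm p (f x - bary_vec z w f x) | x in range zeta] < eps)
  (F_scaled : forall j, lp_norm +oo%E (col j (sample_mx f zeta))^T = 1) :
  let F := sample_mx f zeta in
  let Fm := sample_mx (bary_vec z w f) zeta in
  let FZ := sample_mx f z in
  [/\ (\rank Fm <= m)%N,
      \rank Fm = m <-> row_free FZ
    & exists H : 'M[R[i]]_(n, m),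
        Fm = H *m FZ /\
        exists I : 'I_m -> 'I_n,
          (forall nu, zeta (I nu) = z nu) /\
          approx_RID (lpinf_norm p (N:=N)) eps F Fm H I].
Proof.
move=> F Fm FZ.
pose I nu := iinv (z_sub nu).
have zetaI nu : zeta (I nu) = z nu by exact: f_iinv.
have FmFZ : (Fm <= FZ)%MS by exact: sample_bary_sub.
have FZFm : (FZ <= Fm)%MS.
  have -> : FZ = rowsub I Fm.
    by apply/matrixP => nu j; rewrite !mxE zetaI bary_support.
  by rewrite rowsubE submxMl.
have rankFm : \rank Fm = \rank FZ.
  by apply/eqP; rewrite eqn_leq !mxrankS.
have rowsubF : rowsub I F = FZ by apply/matrixP => nu j; rewrite !mxE zetaI.
split; first by rewrite rankFm rank_leq_row.
  by rewrite rankFm /row_free; split => [->//|/eqP].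
(* Row space inclusion makes the pseudo-inverse solve [Fm = H *m FZ]. *)
exists (Fm *m pinvmx FZ); rewrite mulmxKpV//; split=> //.
exists I; split=> //; split.
- by move=> nu mu eqI; apply: z_inj; rewrite -!zetaI eqI.
- by rewrite rowsubF mulmxKpV.
- exact: lpinf_norm_lt_sup.
Qed.
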